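(* Let $n\ge1$ and let $U$ be the unitary of any CNOT circuit on $n$ qubits. Then the controlled unitary $c(U)$ can be implemented, by a circuit that may use measurements and classically controlled Clifford corrections, with Toffoli-depth exactly $1$ and Toffoli-count at most $n$, using $2n-1$ clean ancillas.
   Context: A CNOT circuit on $n$ qubits is a product of CNOT gates. For a unitary $U$ on $n$ qubits, $c(U)$ is the unitary on $n+1$ qubits with $c(U)(|0\rangle\otimes|\psi\rangle)=|0\rangle\otimes|\psi\rangle$ and $c(U)(|1\rangle\otimes|\psi\rangle)=|1\rangle\otimes U|\psi\rangle$. Circuits here consist of Clifford gates (generated by $H$, $S$, CNOT; any number, not counted), Toffoli gates on any three qubits, single-qubit Pauli-basis measurements, and Clifford gates that are applied or not depending on earlier measurement outcomes (measurement-based uncomputation). Clean ancillas are additional qubits initialized in $|0\rangle$. The circuit implements $c(U)$ if, for every input state of the $n+1$ qubits and every sequence of measurement outcomes occurring with non-zero probability, the final state of the $n+1$ qubits is $c(U)$ applied to the input (up to a global phase independent of the input), unentangled with the ancillas. Toffoli-count is the number of Toffoli gates; Toffoli-depth is the number of layers of Toffoli gates, a layer being a set of Toffoli gates acting on pairwise disjoint sets of qubits with only Clifford gates, measurements and classically controlled Clifford gates between layers. *)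

(* Defs.v *)
From mathcomp Require Import all_boot all_order all_algebra.
From mathcomp Require Export complex reals.

Set Implicit Arguments.
Unset Strict Implicit.
Unset Printing Implicit Defensive.

Import Order.TTheory GRing.Theory Num.Theory.

Local Open Scope ring_scope.

(** * States

    A vector of the Hilbert space of [N] qubits is the family of its amplitudes
    in the computational basis, which is indexed by the bit assignments of the
    qubits [0, ..., N-1]. *)

Notation bits N := {ffun 'I_N -> bool}.

(* [C^o] rather than [C], so that vectors can be scaled by elements of [C]. *)
Notation qvec C N := {ffun {ffun 'I_N -> bool} -> C^o}.

Definition ket (C : numClosedFieldType) (N : nat) (x : bits N) : qvec C N :=
  [ffun y : bits N => (y == x)%:R].

Definition zeros (C : numClosedFieldType) (N : nat) : qvec C N :=
  ket C [ffun _ : 'I_N => false].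

Definition normsq (C : numClosedFieldType) (N : nat) (psi : qvec C N) : C :=
  \sum_(x : bits N) `|psi x| ^+ 2.

Definition is_state (C : numClosedFieldType) (N : nat) (psi : qvec C N) : Prop :=
  normsq psi = 1.

Definition lbits (M N : nat) (x : bits (M + N)) : bits M :=
  [ffun i => x (lshift N i)].

Definition rbits (M N : nat) (x : bits (M + N)) : bits N :=
  [ffun j => x (rshift M j)].

Definition catbits (M N : nat) (x : bits M) (y : bits N) : bits (M + N) :=
  [ffun i => match split i with inl j => x j | inr j => y j end].

(* The first [M] qubits are those of [psi], the last [N] those of [phi]. *)
Definition tensor (C : numClosedFieldType) (M N : nat)
    (psi : qvec C M) (phi : qvec C N) : qvec C (M + N) :=
  [ffun x : bits (M + N) => psi (lbits x) * phi (rbits x)].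

(** * Gates *)

Definition setbit (N : nat) (x : bits N) (q : 'I_N) (b : bool) : bits N :=
  [ffun j => if j == q then b else x j].

(* [G a b] is the entry in row [a] and column [b] of a 2x2 matrix. *)
Definition apply1 (C : numClosedFieldType) (N : nat) (G : bool -> bool -> C)
    (q : 'I_N) (psi : qvec C N) : qvec C N :=
  [ffun x : bits N => \sum_(b : bool) G (x q) b * psi (setbit x q b)].

Definition hadamard_mx (C : numClosedFieldType) (a b : bool) : C :=
  (-1) ^+ (a && b) / sqrtC 2.

Definition phase_mx (C : numClosedFieldType) (a b : bool) : C :=
  if a == b then 'i ^+ a else 0.

Record cnot (N : nat) := Cnot {
  cnot_ctl : 'I_N;
  cnot_tgt : 'I_N;
  _ : cnot_ctl != cnot_tgt }.

(* The gate permutes the basis states by an involution (the control is not the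
   target), so it acts on amplitudes by composition with that involution; see
   [apply_cnot_ket]. *)
Definition cnot_bits (N : nat) (g : cnot N) (x : bits N) : bits N :=
  setbit x (cnot_tgt g) (x (cnot_tgt g) (+) x (cnot_ctl g)).

Definition apply_cnot (C : numClosedFieldType) (N : nat) (g : cnot N)
    (psi : qvec C N) : qvec C N :=
  [ffun x : bits N => psi (cnot_bits g x)].

Record toffoli (N : nat) := Toffoli {
  tof_ctl1 : 'I_N;
  tof_ctl2 : 'I_N;
  tof_tgt : 'I_N;
  _ : uniq [:: tof_ctl1; tof_ctl2; tof_tgt] }.

Definition tof_qubits (N : nat) (t : toffoli N) : seq 'I_N :=
  [:: tof_ctl1 t; tof_ctl2 t; tof_tgt t].

Definition tof_bits (N : nat) (t : toffoli N) (x : bits N) : bits N :=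
  setbit x (tof_tgt t) (x (tof_tgt t) (+) (x (tof_ctl1 t) && x (tof_ctl2 t))).

Definition apply_toffoli (C : numClosedFieldType) (N : nat) (t : toffoli N)
    (psi : qvec C N) : qvec C N :=
  [ffun x : bits N => psi (tof_bits t x)].

(** * CNOT circuits and controlled operators *)

(* The gate at the head of the sequence is applied first. *)
Definition cnot_circuit (C : numClosedFieldType) (N : nat) (w : seq (cnot N))
    (psi : qvec C N) : qvec C N :=
  foldl (fun phi g => apply_cnot g phi) psi w.

(* The control is qubit 0 and [U] acts on the others; see [controlled0] and
   [controlled1]. *)
Definition controlled (C : numClosedFieldType) (n : nat)
    (U : qvec C n -> qvec C n) (psi : qvec C (1 + n)) : qvec C (1 + n) :=
  [ffun x : bits (1 + n) =>
     if x (lshift n ord0)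
     then U [ffun y : bits n => psi (catbits [ffun _ : 'I_1 => true] y)] (rbits x)
     else psi x].

(** * Circuits with measurements *)

Inductive clifford_gen (N : nat) :=
  | Hgate of 'I_N
  | Sgate of 'I_N
  | CNOTgate of cnot N.

Definition apply_gen (C : numClosedFieldType) (N : nat) (g : clifford_gen N)
    (psi : qvec C N) : qvec C N :=
  match g with
  | Hgate q => apply1 (hadamard_mx C) q psi
  | Sgate q => apply1 (phase_mx C) q psi
  | CNOTgate g => apply_cnot g psi
  end.

Definition clifford (N : nat) := seq (clifford_gen N).

Definition apply_clifford (C : numClosedFieldType) (N : nat) (g : clifford N)
    (psi : qvec C N) : qvec C N :=
  foldl (fun phi s => apply_gen s phi) psi g.

Inductive pauli := PauliX | PauliY | PauliZ.

Definition pauli_mx (C : numClosedFieldType) (P : pauli) (a b : bool) : C :=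
  match P with
  | PauliX => if a == b then 0 else 1
  | PauliY => if a == b then 0 else (-1) ^+ b * 'i
  | PauliZ => if a == b then (-1) ^+ a else 0
  end.

(* The orthogonal projection [(1 + (-1)^b P_q) / 2] on the eigenspace of the
   Pauli [P] on qubit [q] for the eigenvalue [(-1)^b]. *)
Definition pauli_proj (C : numClosedFieldType) (N : nat) (P : pauli) (q : 'I_N)
    (b : bool) (psi : qvec C N) : qvec C N :=
  (2^-1 : C) *: (psi + ((-1) ^+ b : C) *: apply1 (pauli_mx C P) q psi).

Record toffoli_layer (N : nat) := ToffoliLayer {
  layer_gates : seq (toffoli N);
  _ : (0 < size layer_gates)%N;
  _ : uniq (flatten [seq tof_qubits t | t <- layer_gates]) }.

Definition apply_layer (C : numClosedFieldType) (N : nat) (l : toffoli_layer N)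
    (psi : qvec C N) : qvec C N :=
  foldl (fun phi t => apply_toffoli t phi) psi (layer_gates l).

(* In [CondClifford f g] the function [f] receives all the measurement outcomes
   obtained so far, the oldest first, and decides whether [g] is applied. *)
Inductive instr (N : nat) :=
  | Clifford of clifford N
  | Layer of toffoli_layer N
  | Measure of pauli & 'I_N
  | CondClifford of (seq bool -> bool) & clifford N.

Definition circuit (N : nat) := seq (instr N).

Definition is_layer (N : nat) (s : instr N) : bool :=
  if s is Layer _ then true else false.

Definition is_measure (N : nat) (s : instr N) : bool :=
  if s is Measure _ _ then true else false.

Definition toffoli_depth (N : nat) (c : circuit N) : nat :=
  count (@is_layer N) c.

Definition toffoli_count (N : nat) (c : circuit N) : nat :=
  (\sum_(s <- c) (if s is Layer l then size (layer_gates l) else 0))%N.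

Definition measure_count (N : nat) (c : circuit N) : nat :=
  count (@is_measure N) c.

(* The unnormalised result of running [c] on [psi] when the successive
   measurement outcomes are the entries of [m] from position [k] on, the first
   [k] entries being the outcomes of measurements made before [c]. *)
Fixpoint run (C : numClosedFieldType) (N : nat) (m : seq bool) (k : nat)
    (c : circuit N) (psi : qvec C N) : qvec C N :=
  match c with
  | [::] => psi
  | Clifford g :: c' => run m k c' (apply_clifford g psi)
  | Layer l :: c' => run m k c' (apply_layer l psi)
  | Measure P q :: c' => run m k.+1 c' (pauli_proj P q (nth false m k) psi)
  | CondClifford f g :: c' =>
      run m k c' (if f (take k m) then apply_clifford g psi else psi)
  end.

(* Since the projections are not followed by renormalisation in [run], the Born
   rule gives the joint probability of the whole outcome sequence [m]. *)
Definition outcome_prob (C : numClosedFieldType) (N : nat) (c : circuit N)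
    (m : seq bool) (psi : qvec C N) : C :=
  normsq (run m 0 c psi).

Definition final_state (C : numClosedFieldType) (N : nat) (c : circuit N)
    (m : seq bool) (psi : qvec C N) : qvec C N :=
  (sqrtC (outcome_prob c m psi))^-1 *: run m 0 c psi.

(* The [N] input qubits come first, followed by [k] ancillas initialised to 0.
   The phase [z] and the state [a] in which the ancillas are left may depend on
   the measurement outcomes, but not on the input. *)
Definition implements (C : numClosedFieldType) (N k : nat)
    (c : circuit (N + k)) (V : qvec C N -> qvec C N) : Prop :=
  forall m : (measure_count c).-tuple bool,
  exists (z : C) (a : qvec C k),
    [/\ `|z| = 1, is_state a &
      forall psi : qvec C N, is_state psi ->
        outcome_prob c m (tensor psi (zeros C k)) != 0 ->
        final_state c m (tensor psi (zeros C k)) = z *: tensor (V psi) a].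

(** * Characterisations of the encodings *)

Lemma cnot_bitsK (N : nat) (g : cnot N) : involutive (cnot_bits g).
Proof.
case: g => a t /= neq x; apply/ffunP => j; rewrite !ffunE /= !eqxx.
by case: eqVneq => [->|//]; rewrite (negbTE neq) addbK.
Qed.

Lemma tof_bitsK (N : nat) (t : toffoli N) : involutive (tof_bits t).
Proof.
case: t => a b t /= U x; apply/ffunP => j; rewrite !ffunE /= !eqxx.
case: eqVneq => [->|//]; move: U; rewrite !inE negb_or andbT.
by case/andP=> /andP[_ /negbTE->] /negbTE->; rewrite addbK.
Qed.

Lemma apply_cnot_ket (C : numClosedFieldType) (N : nat) (g : cnot N) (x : bits N) :
  apply_cnot g (ket C x) = ket C (cnot_bits g x).
Proof.
by apply/ffunP => y; rewrite !ffunE (can2_eq (cnot_bitsK g) (cnot_bitsK g)).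
Qed.

Lemma apply_toffoli_ket (C : numClosedFieldType) (N : nat) (t : toffoli N)
    (x : bits N) :
  apply_toffoli t (ket C x) = ket C (tof_bits t x).
Proof.
by apply/ffunP => y; rewrite !ffunE (can2_eq (tof_bitsK t) (tof_bitsK t)).
Qed.

Lemma cnot_circuit_linear (C : numClosedFieldType) (N : nat) (w : seq (cnot N)) :
  linear (@cnot_circuit C N w).
Proof.
elim: w => [//|g w IHw] a u v; rewrite /cnot_circuit /=.
by rewrite -[RHS]IHw; congr (foldl _ _ _); apply/ffunP => x; rewrite !ffunE.
Qed.

Lemma lbits_cat (M N : nat) (x : bits M) (y : bits N) : lbits (catbits x y) = x.
Proof.
by apply/ffunP => i; rewrite !ffunE; case: split_ordP => j /eqP;
   rewrite ?eq_shift // => /eqP->.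
Qed.

Lemma rbits_cat (M N : nat) (x : bits M) (y : bits N) : rbits (catbits x y) = y.
Proof.
by apply/ffunP => i; rewrite !ffunE; case: split_ordP => j /eqP;
   rewrite ?eq_shift // => /eqP->.
Qed.

Lemma controlled0 (C : numClosedFieldType) (n : nat) (U : qvec C n -> qvec C n)
    (psi : qvec C n) : linear U ->
  let ket0 := ket C [ffun _ : 'I_1 => false] in
  controlled U (tensor ket0 psi) = tensor ket0 psi.
Proof.
move=> linU /=; apply/ffunP => x; rewrite !ffunE; case: ifP => // x0.
have -> : [ffun y : bits n => tensor (ket C [ffun _ : 'I_1 => false]) psi
             (catbits [ffun _ : 'I_1 => true] y)] = 0.
  apply/ffunP => y; rewrite !ffunE lbits_cat (_ : _ == _ = false) ?mul0r //.
  by apply/eqP => /ffunP/(_ ord0); rewrite !ffunE.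
have U0 : U 0 = 0 by move: (linU (-1) 0 0); rewrite scaler0 addr0 scaleN1r addNr.
rewrite U0 ffunE (_ : _ == _ = false) ?mul0r //.
by apply/eqP => /ffunP/(_ ord0); rewrite !ffunE x0.
Qed.

Lemma controlled1 (C : numClosedFieldType) (n : nat) (U : qvec C n -> qvec C n)
    (psi : qvec C n) :
  let ket1 := ket C [ffun _ : 'I_1 => true] in
  controlled U (tensor ket1 psi) = tensor ket1 (U psi).
Proof.
move=> /=; apply/ffunP => x; rewrite !ffunE; case: ifP => x0.
  have -> : lbits x = [ffun _ : 'I_1 => true].
    by apply/ffunP => i; rewrite !ffunE (ord1 i).
  rewrite eqxx mul1r; congr (U _ _); apply/ffunP => y.
  by rewrite !ffunE lbits_cat rbits_cat eqxx mul1r.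
rewrite (_ : _ == _ = false) ?mul0r //.
by apply/eqP => /ffunP/(_ ord0); rewrite !ffunE x0.
Qed.

(* Main.v *)
(** Let [W] be the linear map on bit strings of the CNOT circuit. Fan the control
    [c] out to [n - 1] ancillas, so that the [n] Toffoli gates writing [z = c x]
    into [n] further ancillas act on disjoint qubits, and undo the fan-out. Adding
    [z] to [x], running the CNOT circuit on [z] and adding [z] again takes [x] to
    [x + c x + c W x], the [x]-part of the output of the controlled circuit, and
    leaves [z = c W x], which is [c] times the new [x]. Measuring [z_i] in the X
    basis with outcome 1 therefore leaves the phase [(-1)^(c x_i)], which a CZ
    gate on [c] and [x_i] removes. *)

Require Import Defs.
From mathcomp Require Import all_boot all_order all_algebra.
From mathcomp Require Import complex reals.
From mathcomp Require Import ring.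

Set Implicit Arguments.
Unset Strict Implicit.
Unset Printing Implicit Defensive.

Import Order.TTheory GRing.Theory Num.Theory.

Lemma catbits_lrbits M K (x : bits (M + K)) : catbits (lbits x) (rbits x) = x.
Proof. by apply/ffunP => i; rewrite !ffunE; case: split_ordP => j ->; rewrite ffunE. Qed.

Section States.

Variable C : numClosedFieldType.

Lemma sum_lrbits (M N : nat) (f : bits M -> C) (g : bits N -> C) :
  (\sum_(x : bits (M + N)) f (lbits x) * g (rbits x) =
   (\sum_x f x) * (\sum_y g y))%R.
Proof.
rewrite big_distrlr /= pair_big /=.
rewrite (reindex (fun p : bits M * bits N => catbits p.1 p.2)) /=.
  by apply: eq_bigr => p _; rewrite lbits_cat rbits_cat.
exists (fun x => (lbits x, rbits x)) => [[x y] _|x _] /=.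
  by rewrite lbits_cat rbits_cat.
exact: catbits_lrbits.
Qed.

Lemma normsq_tensor (M N : nat) (psi : qvec C M) (phi : qvec C N) :
  normsq (tensor psi phi) = (normsq psi * normsq phi)%R.
Proof.
rewrite /normsq -sum_lrbits; apply: eq_bigr => x _.
by rewrite ffunE normrM exprMn.
Qed.

Lemma normsqZ (N : nat) (a : C) (psi : qvec C N) :
  normsq (a *: psi)%R = (`|a| ^+ 2 * normsq psi)%R.
Proof.
rewrite /normsq mulr_sumr; apply: eq_bigr => x _.
by rewrite ffunE normrM exprMn.
Qed.

Lemma normsq_gt0 (N : nat) (psi : qvec C N) (x : bits N) :
  psi x != 0%R -> (0 < normsq psi)%R.
Proof.
move=> psix; rewrite /normsq (bigD1 x) //= ltr_pwDl ?exprn_gt0 ?normr_gt0 //.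
by apply: sumr_ge0 => y _; rewrite exprn_ge0.
Qed.

Lemma tensorZr (M N : nat) (a : C) (psi : qvec C M) (phi : qvec C N) :
  tensor psi (a *: phi)%R = (a *: tensor psi phi)%R.
Proof. by apply/ffunP => x; rewrite !ffunE /GRing.scale /= mulrCA. Qed.

Lemma implements_product (N k : nat) (c : circuit (N + k))
    (V : qvec C N -> qvec C N) :
  (forall psi, normsq (V psi) = normsq psi) ->
  (forall m : seq bool, exists2 a : qvec C k, exists y, a y != 0%R &
     forall psi, run m 0 c (tensor psi (zeros C k)) = tensor (V psi) a) ->
  implements c V.
Proof.
move=> isoV runE m; have [a [y ay] {}runE] := runE m.
have ngt0 := normsq_gt0 ay.
exists 1%R, ((sqrtC (normsq a))^-1 *: a)%R; split; first by rewrite normr1.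
  rewrite /is_state normsqZ ger0_norm ?invr_ge0 ?sqrtC_ge0 ?(ltW ngt0) //.
  by rewrite exprVn sqrtCK mulVf ?gt_eqF.
move=> psi psi1 _; rewrite /final_state /outcome_prob runE normsq_tensor.
by rewrite isoV psi1 mul1r scale1r tensorZr.
Qed.

End States.

Section BitMaps.

Variables (C : numClosedFieldType) (N : nat).

Definition cnots (s : seq (cnot N)) : clifford N := map (@CNOTgate N) s.

Lemma apply_cnots (s : seq (cnot N)) (psi : qvec C N) :
  apply_clifford (cnots s) psi = [ffun x => psi (foldr (@cnot_bits N) x s)].
Proof.
elim: s psi => [|g s IHs] psi; first by apply/ffunP => x; rewrite ffunE.
by rewrite [LHS]IHs; apply/ffunP => x; rewrite !ffunE.
Qed.

Lemma cnot_circuitE (s : seq (cnot N)) (psi : qvec C N) :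
  cnot_circuit s psi = [ffun x => psi (foldr (@cnot_bits N) x s)].
Proof.
elim: s psi => [|g s IHs] psi; first by apply/ffunP => x; rewrite ffunE.
by rewrite [LHS]IHs; apply/ffunP => x; rewrite !ffunE.
Qed.

Lemma apply_toffolis (s : seq (toffoli N)) (psi : qvec C N) :
  foldl (fun phi t => apply_toffoli t phi) psi s =
  [ffun x => psi (foldr (@tof_bits N) x s)].
Proof.
elim: s psi => [|g s IHs] psi; first by apply/ffunP => x; rewrite ffunE.
by rewrite [LHS]IHs; apply/ffunP => x; rewrite !ffunE.
Qed.

Lemma cnots_inj (s : seq (cnot N)) :
  injective (fun x => foldr (@cnot_bits N) x s).
Proof. by elim: s => // g s IHs x y /= /(can_inj (cnot_bitsK g))/IHs. Qed.

Lemma cnots_zero (s : seq (cnot N)) :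
  foldr (@cnot_bits N) [ffun=> false] s = [ffun=> false].
Proof.
elim: s => //= g s ->; apply/ffunP => j.
by rewrite !ffunE; case: ifP.
Qed.

(* All the updates read the initial values since no [h i] sees a target. *)
Lemma foldr_xorbits (I : Type) (t : I -> 'I_N) (h : I -> bits N -> bool)
    (s : seq I) (x : bits N) :
  (forall i x k b, h i (setbit x (t k) b) = h i x) ->
  foldr (fun i y => setbit y (t i) (y (t i) (+) h i y)) x s =
  [ffun j => x j (+) \big[addb/false]_(i <- s | t i == j) h i x].
Proof.
move=> ht; elim: s => [|i s IHs] /=.
  by apply/ffunP => j; rewrite ffunE big_nil addbF.
have hE : h i (foldr (fun i y => setbit y (t i) (y (t i) (+) h i y)) x s) = h i x.
  by elim: s {IHs} => //= k s IHs; rewrite ht.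
rewrite hE IHs; apply/ffunP => j; rewrite !ffunE big_cons [t i == j]eq_sym.
by case: eqP => // ->; rewrite [h i x (+) _]addbC addbA.
Qed.

Variable I : finType.

Lemma cnots_parallel (g : I -> cnot N) (x : bits N) :
  (forall i k, cnot_ctl (g i) != cnot_tgt (g k)) ->
  foldr (@cnot_bits N) x [seq g i | i <- enum I] =
  [ffun j => x j (+) \big[addb/false]_(i | cnot_tgt (g i) == j) x (cnot_ctl (g i))].
Proof.
move=> dis; rewrite foldr_map.
rewrite (foldr_xorbits (t := fun i => cnot_tgt (g i)) (h := fun i y => y (cnot_ctl (g i)))).
  by apply/ffunP => j; rewrite !ffunE big_enum_cond.
by move=> i y k b; rewrite ffunE (negbTE (dis i k)).
Qed.

Lemma toffolis_parallel (g : I -> toffoli N) (x : bits N) :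
  (forall i k, tof_ctl1 (g i) != tof_tgt (g k)) ->
  (forall i k, tof_ctl2 (g i) != tof_tgt (g k)) ->
  foldr (@tof_bits N) x [seq g i | i <- enum I] =
  [ffun j => x j (+) \big[addb/false]_(i | tof_tgt (g i) == j)
                        (x (tof_ctl1 (g i)) && x (tof_ctl2 (g i)))].
Proof.
move=> dis1 dis2; rewrite foldr_map.
rewrite (foldr_xorbits (t := fun i => tof_tgt (g i))
  (h := fun i y => y (tof_ctl1 (g i)) && y (tof_ctl2 (g i)))).
  by apply/ffunP => j; rewrite !ffunE big_enum_cond.
by move=> i y k b; rewrite !ffunE (negbTE (dis1 i k)) (negbTE (dis2 i k)).
Qed.

End BitMaps.

Section EmbeddedCnots.

Variables (n N : nat) (e : 'I_n -> 'I_N) (einj : injective e).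

Lemma embed_cnot_subproof (g : cnot n) : e (cnot_ctl g) != e (cnot_tgt g).
Proof. by case: g => a b /=; rewrite inj_eq. Qed.

Definition embed_cnot (g : cnot n) : cnot N := Cnot (embed_cnot_subproof g).

Lemma embed_cnots_in (s : seq (cnot n)) (x : bits N) (i : 'I_n) :
  foldr (@cnot_bits N) x (map embed_cnot s) (e i) =
  foldr (@cnot_bits n) [ffun i => x (e i)] s i.
Proof.
elim: s i => [|g s IHs] i /=; first by rewrite ffunE.
by rewrite !ffunE /= inj_eq // !IHs.
Qed.

Lemma embed_cnots_out (s : seq (cnot n)) (x : bits N) (j : 'I_N) :
  (forall i, j != e i) -> foldr (@cnot_bits N) x (map embed_cnot s) j = x j.
Proof.
move=> je; elim: s => //= g s IHs.
by rewrite !ffunE /= (negbTE (je _)).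
Qed.

End EmbeddedCnots.

Lemma uniq_flatten_disjoint (I T : eqType) (F : I -> seq T) (s : seq I) :
  uniq s -> (forall i, uniq (F i)) ->
  (forall i k y, y \in F i -> y \in F k -> i = k) ->
  uniq (flatten [seq F i | i <- s]).
Proof.
move=> us uF dis; elim: s us => //= i s IHs /andP[nis us].
rewrite cat_uniq uF IHs // andbT; apply/hasPn => y /flattenP[_ /mapP[k ks ->] yk].
by apply: contra nis => yi; rewrite (dis _ _ _ yi yk).
Qed.

Section Phases.

Variables (C : numClosedFieldType) (N : nat).
Local Open Scope ring_scope.

Lemma setbit_id (x : bits N) (q : 'I_N) : setbit x q (x q) = x.
Proof. by apply/ffunP => j; rewrite ffunE; case: eqP => [->|]. Qed.

Lemma setbit_setbit (x : bits N) (q : 'I_N) (a b : bool) :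
  setbit (setbit x q a) q b = setbit x q b.
Proof. by apply/ffunP => j; rewrite !ffunE; case: eqP. Qed.

Lemma pauli_projX (q : 'I_N) (b : bool) (psi : qvec C N) (x : bits N) :
  pauli_proj PauliX q b psi x =
  2^-1 * (psi x + (-1) ^+ b * psi (setbit x q (~~ x q))).
Proof.
rewrite !ffunE /GRing.scale /= big_bool /=.
by case: (x q); rewrite /= ?mul0r ?mul1r ?add0r ?addr0.
Qed.

Variables (c q : 'I_N) (cq : c != q).

Definition cz : clifford N := [:: Hgate q; CNOTgate (Cnot cq); Hgate q].

Lemma apply_cz (psi : qvec C N) (x : bits N) :
  apply_clifford cz psi x = (-1) ^+ (x c && x q) * psi x.
Proof.
have s2 : 2 * ((sqrtC 2 : C)^-1 * (sqrtC 2)^-1) = 1.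
  by rewrite -invfM -expr2 sqrtCK divff ?pnatr_eq0.
rewrite !ffunE !big_bool !ffunE !big_bool /cnot_bits /=.
rewrite !(setbit_setbit, ffunE) !eqxx (negbTE cq) /hadamard_mx.
rewrite -[X in _ = _ * psi X](setbit_id x q) -[RHS]mul1r -[X in _ = X * _]s2.
by case: (x c); case: (x q) => /=; ring.
Qed.

End Phases.

Section Construction.

Variables (C : numClosedFieldType) (m : nat) (w : seq (cnot m.+1)).
Local Notation n := m.+1.
Local Notation N := ((1 + n) + (n + m)).

Definition cq : 'I_N := lshift (n + m) (lshift n ord0).
Definition xq (i : 'I_n) : 'I_N := lshift (n + m) (rshift 1 i).
Definition zq (i : 'I_n) : 'I_N := rshift (1 + n) (lshift m i).
Definition kq (j : 'I_m) : 'I_N := rshift (1 + n) (rshift n j).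

Definition copy (i : 'I_n) : 'I_N := if unlift ord0 i is Some j then kq j else cq.

Lemma xq_inj : injective xq.
Proof. by move=> i j /eqP; rewrite /xq /zq !eq_shift => /eqP. Qed.

Lemma zq_inj : injective zq.
Proof. by move=> i j /eqP; rewrite /xq /zq !eq_shift => /eqP. Qed.

Lemma copy_inj : injective copy.
Proof.
move=> i j; rewrite /copy; case: unliftP => [a|] ->; case: unliftP => [b|] -> //.
all: by move/eqP; rewrite /kq /cq !eq_shift // => /eqP ->.
Qed.

Lemma cq_neq_kq j : cq != kq j. Proof. by rewrite /cq /kq eq_shift. Qed.
Lemma cq_neq_xq i : cq != xq i. Proof. by rewrite /cq /xq !eq_shift. Qed.
Lemma zq_neq_xq i k : zq i != xq k. Proof. by rewrite /zq /xq !eq_shift. Qed.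
Lemma xq_neq_zq i k : xq i != zq k. Proof. by rewrite /zq /xq !eq_shift. Qed.
Lemma copy_neq_xq i k : copy i != xq k.
Proof. by rewrite /copy /xq; case: unlift => [j|]; rewrite /kq /cq !eq_shift. Qed.
Lemma copy_neq_zq i k : copy i != zq k.
Proof. by rewrite /copy /zq; case: unlift => [j|]; rewrite /kq /cq !eq_shift. Qed.

Definition fan : seq (cnot N) := [seq Cnot (cq_neq_kq j) | j <- enum 'I_m].
Definition addz : seq (cnot N) := [seq Cnot (zq_neq_xq i i) | i <- enum 'I_n].

Lemma tof_subproof (i : 'I_n) : uniq [:: copy i; xq i; zq i].
Proof. by rewrite /= !inE negb_or copy_neq_xq copy_neq_zq xq_neq_zq. Qed.

Definition tof (i : 'I_n) : toffoli N := Toffoli (tof_subproof i).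

Lemma tofs_size : 0 < size [seq tof i | i <- enum 'I_n].
Proof. by rewrite size_map size_enum_ord. Qed.

Lemma tofs_uniq :
  uniq (flatten [seq tof_qubits t | t <- [seq tof i | i <- enum 'I_n]]).
Proof.
rewrite -map_comp; apply: uniq_flatten_disjoint; first exact: enum_uniq.
  exact: tof_subproof.
move=> i k y /=; rewrite !inE => /or3P[]/eqP->.
all: rewrite /= 1?[xq _ == copy _]eq_sym 1?[zq _ == copy _]eq_sym.
all: rewrite 1?[zq _ == xq _]eq_sym ?(negbTE (copy_neq_xq _ _)).
all: rewrite ?(negbTE (copy_neq_zq _ _)) ?(negbTE (xq_neq_zq _ _)) ?orbF /=.
all: by rewrite ?(inj_eq copy_inj) ?(inj_eq xq_inj) ?(inj_eq zq_inj) => /eqP.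
Qed.

Definition fan_bits (x : bits N) : bits N := foldr (@cnot_bits N) x fan.
Definition addz_bits (x : bits N) : bits N := foldr (@cnot_bits N) x addz.
Definition tof_layer_bits (x : bits N) : bits N :=
  foldr (@tof_bits N) x [seq tof i | i <- enum 'I_n].
Definition wz : seq (cnot N) := map (embed_cnot zq_inj) w.
Definition wz_bits (x : bits N) : bits N := foldr (@cnot_bits N) x wz.

Lemma fan_bitsE x : (fan_bits x cq = x cq) *
  (forall i, fan_bits x (xq i) = x (xq i)) *
  (forall i, fan_bits x (zq i) = x (zq i)) *
  (forall j, fan_bits x (kq j) = x (kq j) (+) x cq).
Proof.
rewrite /fan_bits cnots_parallel => [|i k]; last exact: cq_neq_kq.
do 3?split; [|move=> i|move=> i|move=> j]; rewrite ffunE /=.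
- by rewrite big_pred0 ?addbF // => k; rewrite eq_sym (negbTE (cq_neq_kq k)).
- by rewrite big_pred0 ?addbF // => k; rewrite /kq /xq !eq_shift.
- by rewrite big_pred0 ?addbF // => k; rewrite /kq /zq !eq_shift.
- by rewrite (big_pred1 j) // => k; rewrite /kq !eq_shift.
Qed.

Lemma addz_bitsE x : (addz_bits x cq = x cq) *
  (forall i, addz_bits x (xq i) = x (xq i) (+) x (zq i)) *
  (forall i, addz_bits x (zq i) = x (zq i)) *
  (forall j, addz_bits x (kq j) = x (kq j)).
Proof.
rewrite /addz_bits cnots_parallel => [|i k]; last exact: zq_neq_xq.
do 3?split; [|move=> i|move=> i|move=> j]; rewrite ffunE /=.
- by rewrite big_pred0 ?addbF // => k; rewrite eq_sym (negbTE (cq_neq_xq k)).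
- by rewrite (big_pred1 i) // => k; rewrite /xq !eq_shift.
- by rewrite big_pred0 ?addbF // => k; rewrite /zq /xq !eq_shift.
- by rewrite big_pred0 ?addbF // => k; rewrite /kq /xq !eq_shift.
Qed.

Lemma tof_layer_bitsE x : (tof_layer_bits x cq = x cq) *
  (forall i, tof_layer_bits x (xq i) = x (xq i)) *
  (forall i, tof_layer_bits x (zq i) = x (zq i) (+) (x (copy i) && x (xq i))) *
  (forall j, tof_layer_bits x (kq j) = x (kq j)).
Proof.
rewrite /tof_layer_bits toffolis_parallel => [|i k|i k].
- do 3?split; [|move=> i|move=> i|move=> j]; rewrite ffunE /=.
  + by rewrite big_pred0 ?addbF // => k; rewrite /zq /cq !eq_shift.
  + by rewrite big_pred0 ?addbF // => k; rewrite /zq /xq !eq_shift.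
  + by rewrite (big_pred1 i) // => k; rewrite /zq !eq_shift.
  + by rewrite big_pred0 ?addbF // => k; rewrite /kq /zq !eq_shift.
- exact: copy_neq_zq.
- exact: xq_neq_zq.
Qed.

Lemma wz_bitsE x : (wz_bits x cq = x cq) *
  (forall i, wz_bits x (xq i) = x (xq i)) *
  (forall i, wz_bits x (zq i) = foldr (@cnot_bits n) [ffun i => x (zq i)] w i) *
  (forall j, wz_bits x (kq j) = x (kq j)).
Proof.
rewrite /wz_bits; do 3?split; [|move=> k|move=> k|move=> k].
- by apply: embed_cnots_out => i; rewrite /cq /zq !eq_shift.
- by apply: embed_cnots_out => i; rewrite /xq /zq !eq_shift.
- exact: embed_cnots_in.
- by apply: embed_cnots_out => i; rewrite /kq /zq !eq_shift.
Qed.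

Local Open Scope ring_scope.

Definition uncompute (i : 'I_n) : circuit N :=
  [:: Measure PauliX (zq i);
      CondClifford (fun o => nth false o i) (cz (cq_neq_xq i))].

Definition uncomputed (i : 'I_n) (b : bool) (phi : qvec C N) : qvec C N :=
  let phi' := pauli_proj PauliX (zq i) b phi in
  if b then apply_clifford (cz (cq_neq_xq i)) phi' else phi'.

Lemma uncomputedE i b phi x :
  uncomputed i b phi x = 2^-1 * (-1) ^+ (b && (x cq && x (xq i))) *
    (phi x + (-1) ^+ b * phi (setbit x (zq i) (~~ x (zq i)))).
Proof.
rewrite /uncomputed; case: b; last by rewrite pauli_projX mulr1.
by rewrite apply_cz pauli_projX mulrCA mulrA.
Qed.

Lemma run_uncompute (o : seq bool) (s : seq 'I_n) (k : nat) (phi : qvec C N) :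
  map val s = iota k (size s) ->
  run o k (flatten [seq uncompute i | i <- s]) phi =
  foldl (fun phi i => uncomputed i (nth false o i) phi) phi s.
Proof.
elim: s k phi => //= i s IHs k phi [<- /IHs{}IHs].
by rewrite nth_take // IHs.
Qed.

(* The state when the qubits [zq i] with [i \in s] are still to be measured. *)
Definition pending (V : qvec C (1 + n)) (o : seq bool) (s : seq 'I_n) : qvec C N :=
  [ffun x => V (lbits x) * ([forall j, ~~ x (kq j)]%:R *
    \prod_i (if i \in s then (x (zq i) == (x cq && x (xq i)))%:R
             else (-1) ^+ (nth false o i && x (zq i)) / 2))].

Lemma uncomputed_pending V o i s : i \notin s ->
  uncomputed i (nth false o i) (pending V o (i :: s)) = pending V o s.
Proof.
move=> nis; apply/ffunP => x; rewrite uncomputedE.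
set y := setbit _ _ _.
have yz k : y (zq k) = if k == i then ~~ x (zq i) else x (zq k).
  by rewrite ffunE (inj_eq zq_inj).
have yl j : y (lshift (n + m) j) = x (lshift (n + m) j).
  by rewrite ffunE /zq !eq_shift.
have yc : y cq = x cq := yl _.
have yx k : y (xq k) = x (xq k) := yl _.
have yk j : y (kq j) = x (kq j) by rewrite ffunE /zq /kq !eq_shift.
clearbody y.
rewrite !ffunE.
have -> : lbits y = lbits x by apply/ffunP => j; rewrite !ffunE -yl.
have -> : [forall j, ~~ y (kq j)] = [forall j, ~~ x (kq j)].
  by apply: eq_forallb => j; rewrite yk.
have bigi (f : 'I_n -> C) : \prod_k f k = f i * \prod_(k | k != i) f k.
  by rewrite (bigD1 i).
rewrite !bigi mem_head (negbTE nis) yz eqxx yc yx.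
set r := \prod_(k | _) _; set r' := \prod_(k | _) _; set r'' := \prod_(k | _) _.
have -> : r = r''.
  by apply: eq_bigr => k ki; rewrite !inE ?yz (negbTE ki) ?yc ?yx.
have -> : r' = r''.
  by apply: eq_bigr => k ki; rewrite ?inE ?yz (negbTE ki) ?yc ?yx.
move: (nth _ _ _) (x cq) (x (xq i)) (x (zq i)) => [] [] [] [] /=; ring.
Qed.

Lemma foldl_pending V o s : uniq s ->
  foldl (fun phi i => uncomputed i (nth false o i) phi) (pending V o s) s =
  pending V o [::].
Proof. by elim: s => //= i s IHs /andP[nis /IHs]; rewrite uncomputed_pending. Qed.

Definition garbage (o : seq bool) : qvec C (n + m) :=
  [ffun y : bits (n + m) => [forall j : 'I_m, ~~ y (rshift n j)]%:R *
    \prod_(i < n) ((-1) ^+ (nth false o i && y (lshift m i)) / 2)].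

Lemma pending_nil V o : pending V o [::] = tensor V (garbage o).
Proof.
apply/ffunP => x; rewrite !ffunE; congr (_ * (_%:R * _)).
  by congr nat_of_bool; apply: eq_forallb => j; rewrite ffunE.
by apply: eq_bigr => i _; rewrite ffunE.
Qed.

Lemma garbage_neq0 o : garbage o [ffun=> false] != 0.
Proof.
rewrite ffunE mulf_neq0 //.
  rewrite (_ : [forall j, _] = true) ?oner_eq0 //.
  by apply/forallP => j; rewrite ffunE.
apply/prodf_neq0 => i _; rewrite ffunE andbF mulf_neq0 ?oner_eq0 //.
by rewrite invr_eq0 pnatr_eq0.
Qed.

Definition w_bits (x : bits n) : bits n := foldr (@cnot_bits n) x w.

Lemma controlledE (psi : qvec C (1 + n)) (x : bits (1 + n)) :
  controlled (cnot_circuit w) psi x =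
  psi (catbits (lbits x) (if x (lshift n ord0) then w_bits (rbits x) else rbits x)).
Proof.
rewrite !ffunE cnot_circuitE ffunE; case: ifP => x0; rewrite ?ffunE; congr (psi _).
  by congr catbits; apply/ffunP => i; rewrite !ffunE (ord1 i) x0.
by apply/ffunP => i; rewrite !ffunE; case: split_ordP => j ->; rewrite ffunE.
Qed.

Lemma normsq_controlled (psi : qvec C (1 + n)) :
  normsq (controlled (cnot_circuit w) psi) = normsq psi.
Proof.
rewrite /normsq.
pose h (x : bits (1 + n)) :=
  catbits (lbits x) (if x (lshift n ord0) then w_bits (rbits x) else rbits x).
have h_inj : injective h.
  move=> x y hxy; have el : lbits x = lbits y.
    by move/(congr1 (@lbits _ _)): hxy; rewrite !lbits_cat.
  have e0 : x (lshift n ord0) = y (lshift n ord0).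
    by move/ffunP/(_ ord0): el; rewrite !ffunE.
  have er : rbits x = rbits y.
    move/(congr1 (@rbits _ _)): hxy; rewrite !rbits_cat e0.
    by case: ifP => _ //; apply: cnots_inj.
  by rewrite -[x]catbits_lrbits el er catbits_lrbits.
by rewrite [RHS](reindex_inj h_inj); apply: eq_bigr => x _; rewrite controlledE.
Qed.

(* Gates act on amplitudes by precomposition, so the last gate comes innermost
   and [w_bits] is the inverse of the linear map of [w]. *)
Definition inverse_bits (x : bits N) : bits N :=
  fan_bits (tof_layer_bits (fan_bits (addz_bits (wz_bits (addz_bits x))))).

Lemma compute_pending (psi : qvec C (1 + n)) o :
  [ffun x => tensor psi (zeros C (n + m)) (inverse_bits x)] =
  pending (controlled (cnot_circuit w) psi) o (enum 'I_n).
Proof.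
apply/ffunP => x; rewrite !(controlledE, ffunE).
set y := inverse_bits x; set d := w_bits [ffun i => x (zq i)].
have dE : [ffun i => addz_bits x (zq i)] = [ffun i => x (zq i)].
  by apply/ffunP => i; rewrite !ffunE addz_bitsE.
have yE := (fan_bitsE, tof_layer_bitsE, addz_bitsE, wz_bitsE, dE).
have yc : y cq = x cq by rewrite /y /inverse_bits !yE.
have yx i : y (xq i) = x (xq i) (+) x (zq i) (+) d i.
  by rewrite /y /inverse_bits !yE.
have yk j : y (kq j) = x (kq j) by rewrite /y /inverse_bits !yE addbK.
have yz i : (forall j, ~~ x (kq j)) -> y (zq i) = d i (+) (x cq && y (xq i)).
  move=> x0; rewrite yx /y /inverse_bits !yE /copy.
  by case: unlift => [j|]; rewrite !yE ?(negbTE (x0 j)).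
clearbody y => {yE}.
have zero_y : (rbits y == [ffun=> false]) =
    [forall j, ~~ x (kq j)] && [forall i, x (zq i) == x cq && x (xq i)].
  apply/eqP/andP => [/ffunP y0 | [/forallP k0 /forallP/= zx]].
    have k0 j : ~~ x (kq j).
      by have := y0 (rshift n j); rewrite !ffunE -/(kq j) yk => ->.
    have z0 i : d i (+) (x cq && y (xq i)) = false.
      by have := y0 (lshift m i); rewrite !ffunE -/(zq i) yz.
    split; apply/forallP => //= i.
    case: (x cq) z0 => /= z0; last first.
      suff /ffunP/(_ i) : [ffun i => x (zq i)] = [ffun=> false].
        by rewrite !ffunE => ->.
      apply: (@cnots_inj _ w); rewrite cnots_zero; apply/ffunP => k.
      by have := z0 k; rewrite addbF ffunE.
    by have := z0 i; rewrite yx; case: (d i) (x (xq i)) (x (zq i)) => [] [] [].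
  apply/ffunP => j; case: (split_ordP j) => i ->; rewrite !ffunE; last first.
    by rewrite -/(kq i) yk (negbTE (k0 i)).
  rewrite -/(zq i) yz // yx (eqP (zx i)); case: (boolP (x cq)) zx => /= [_|_] zx.
    by rewrite addbb addFb addbb.
  rewrite addbF /d (_ : [ffun i => _] = [ffun=> false]).
    by rewrite /w_bits cnots_zero ffunE.
  by apply/ffunP => k; rewrite !ffunE (eqP (zx k)).
have prodE (b : 'I_n -> bool) : \prod_i (b i)%:R = [forall i, b i]%:R :> C.
  case: forallP => [b1|/forallP]; first by rewrite big1 // => i _; rewrite b1.
  by case/forallPn => i /negbTE bi; rewrite (bigD1 i) //= bi mul0r.
under eq_bigr do rewrite mem_enum /=.
rewrite prodE -natrM mulnb zero_y.
case: andP => [[_ /forallP/= zx]|_]; last by rewrite !mulr0.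
rewrite !mulr1; congr (psi _); rewrite -[LHS]catbits_lrbits; congr catbits.
  by apply/ffunP => i; rewrite !ffunE (ord1 i) -/cq yc.
apply/ffunP => i; rewrite !ffunE -/cq -/(xq i) yx (eqP (zx i)).
case: (boolP (x cq)) zx => /= [_|_] zx.
  rewrite addbb addFb /d; congr (w_bits _ i); apply/ffunP => k.
  by rewrite !ffunE (eqP (zx k)).
rewrite addbF /d (_ : [ffun i => _] = [ffun=> false]).
  by rewrite /w_bits cnots_zero !ffunE addbF.
by apply/ffunP => k; rewrite !ffunE (eqP (zx k)).
Qed.

Definition controlled_circuit : circuit N :=
  [:: Clifford (cnots fan); Layer (ToffoliLayer tofs_size tofs_uniq);
      Clifford (cnots (fan ++ addz ++ wz ++ addz))] ++
  flatten [seq uncompute i | i <- enum 'I_n].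

Lemma run_controlled_circuit (o : seq bool) (psi : qvec C (1 + n)) :
  run o 0 controlled_circuit (tensor psi (zeros C (n + m))) =
  tensor (controlled (cnot_circuit w) psi) (garbage o).
Proof.
rewrite /= run_uncompute; last by rewrite val_enum_ord size_enum_ord.
rewrite -pending_nil -(foldl_pending _ _ (enum_uniq 'I_n)) -compute_pending.
congr foldl; rewrite !apply_cnots /apply_layer apply_toffolis.
by apply/ffunP => x; rewrite !ffunE !foldr_cat.
Qed.

Lemma controlled_circuit_implements :
  implements controlled_circuit (controlled (@cnot_circuit C n w)).
Proof.
apply: implements_product => [|o]; first exact: normsq_controlled.
exists (garbage o); first by exists [ffun=> false]; apply: garbage_neq0.
exact: run_controlled_circuit.
Qed.

Lemma toffoli_depth_controlled_circuit : toffoli_depth controlled_circuit = 1%N.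
Proof. by rewrite /toffoli_depth /=; elim: (enum _) => //= i s ->. Qed.

Lemma toffoli_count_controlled_circuit : toffoli_count controlled_circuit = n.
Proof.
rewrite /toffoli_count big_cat !big_cons big_nil /= size_map size_enum_ord.
by rewrite big_flatten big_map big1 ?addn0 // => i _; rewrite !big_cons big_nil.
Qed.

End Construction.

Theorem theorem4 (R : realType) (n : nat) (hn : 1 <= n) (w : seq (cnot n)) :
  exists c : circuit ((1 + n) + (2 * n - 1)),
    [/\ toffoli_depth c = 1,
        toffoli_count c <= n &
        implements c (controlled (@cnot_circuit R[i] n w))].
Proof.
case: n hn w => // m _ w.
have -> : 2 * m.+1 - 1 = m.+1 + m by rewrite mul2n -addnn addnS subn1.
exists (controlled_circuit w); split.
- exact: toffoli_depth_controlled_circuit.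
- by rewrite toffoli_count_controlled_circuit.
- exact: controlled_circuit_implements.
Qed.
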